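(* Let $n\ge1$. If $\mathcal{F}\subseteq\{0,1,2\}^n$ is $3$-multisum $3$-intersecting, then $|\mathcal{F}|\le\left|\bigcup_{r=n+2}^{2n}2(n,r)\right|+M(n)$, where $M(n)$ denotes the maximum size of a $3$-multisum $3$-intersecting family contained in $2(n,n+1)$.
   Context: $2(n,r)$ denotes the set of vectors in $\{0,1,2\}^n$ whose entries sum to $r$. For $\mathbf{x},\mathbf{y}\in\{0,1,2\}^n$, $|\mathbf{x}\cap_{m,3}\mathbf{y}|=\sum_{i=1}^n\max\{0,x_i+y_i-2\}$; a family $\mathcal{F}$ is $3$-multisum $3$-intersecting if $|\mathbf{x}\cap_{m,3}\mathbf{y}|\ge3$ for any $\mathbf{x},\mathbf{y}\in\mathcal{F}$. *)

(* Defs.v *)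
From mathcomp Require Import all_boot.

Set Implicit Arguments.
Unset Strict Implicit.
Unset Printing Implicit Defensive.

Notation vec3 n := {ffun 'I_n -> 'I_3}.

Definition level (n r : nat) : {set vec3 n} :=
  [set x : vec3 n | \sum_(i < n) x i == r].

(* The sum and the difference are taken in nat; the difference is truncated,
   so the explicit maximum with 0 only records the usual formula. *)
Definition multisum_cap (n : nat) (x y : vec3 n) : nat :=
  \sum_(i < n) maxn 0 (x i + y i - 2).

(* The members x and y are not required to be distinct. *)
Definition multisum_intersecting (n t : nat) (F : {set vec3 n}) : bool :=
  [forall x in F, forall y in F, t <= multisum_cap x y].

Definition max_level_size (n : nat) : nat :=
  \max_(F : {set vec3 n} | multisum_intersecting 3 F &&
                           (F \subset level n n.+1)) #|F|.

(* Main.v *)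
Require Import Defs.
From mathcomp Require Import all_boot.
From mathcomp Require Import all_order all_algebra.
From mathcomp Require Import zify ring.

(** For [x] of weight [r <= n] in the family and [u <= x] of weight [r - 2], the
    complement [2 - u] meets [x] in exactly 2, so it lies outside the family, in
    level [2n + 2 - r]. It thus suffices that the 2-shadow of each level [F_r] is
    at least as large as [F_r]: then levels [r] and [2n + 2 - r] of the family
    together have at most as many elements as level [2n + 2 - r], and the level
    [n + 1] left unpaired contributes at most [M(n)].

    The shadow inequality is a Katona-type theorem, proved by rank: the matrix
    [prod_i C(x_i, u_i)], with [x] in [F_r] and [u] in its shadow, has independent
    rows. For [j <= r - 2], the [z^j]-coefficient of the polynomial [cap_poly x y]
    is, as a function of [y], a combination of columns of that matrix; moreover
    [cap_poly x y] is divisible by [(1 + z)^|x cap y|] and its [z^r]-coefficient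
    is 1 or 0 according to whether [x = y]. A linear dependence between rows makes
    a combination of these polynomials vanish to too high an order at [0] and
    [-1]. *)

Set Implicit Arguments.
Unset Strict Implicit.
Unset Printing Implicit Defensive.

Import GRing.Theory Num.Theory.

(** * Weights, shadows and binomial products *)

Section Shadow.
Variable n : nat.
Implicit Types (x y u v : vec3 n) (F : {set vec3 n}).

Definition wt x : nat := \sum_(i < n) x i.

Definition lev u x : bool := [forall i, u i <= x i].

Definition shadow s F : {set vec3 n} :=
  [set u | [exists x in F, lev u x && (wt x == wt u + s)]].

Definition binv u x : nat := \prod_(i < n) 'C(x i, u i).

(* ['C(2 - u, 2 - x)] equals ['C(2 - u, x - u)] for [u <= x] and, unlike the
   latter with truncated subtraction, vanishes for [x < u]. *)
Definition cobinv u x : nat := \prod_(i < n) 'C(2 - u i, 2 - x i).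

Lemma wt_lev u x : lev u x -> wt u <= wt x.
Proof. by move=> /forallP ux; apply: leq_sum => i _. Qed.

Lemma lev_wt_eq u x : lev u x -> wt x <= wt u -> u = x.
Proof.
move=> ux le_xu.
have : \sum_(i < n) (x i - u i) == 0.
  rewrite sumnB; last by move=> i _; apply: (forallP ux).
  by rewrite subn_eq0.
rewrite sum_nat_eq0 => /forallP x_u; apply/ffunP => i; apply: val_inj.
by apply/eqP; rewrite eqn_leq (forallP ux) -subn_eq0; apply: (x_u i).
Qed.

Lemma binv_eq0 u x : ~~ lev u x -> binv u x = 0.
Proof.
rewrite negb_forall => /existsP[i]; rewrite -ltnNge => lt_xu.
by rewrite /binv (bigD1 i) //= bin_small.
Qed.

Lemma cobinv_eq0 u x : ~~ lev u x -> cobinv u x = 0.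
Proof.
rewrite negb_forall => /existsP[i]; rewrite -ltnNge => lt_xu.
rewrite /cobinv (bigD1 i) //= bin_small // ltn_sub2l //.
by apply: leq_trans lt_xu _; rewrite -ltnS.
Qed.

Lemma binvv x : binv x x = 1.
Proof. by rewrite /binv big1 // => i _; rewrite binn. Qed.

Lemma cobinvv x : cobinv x x = 1.
Proof. by rewrite /cobinv big1 // => i _; rewrite binn. Qed.

(** * Generating polynomials graded by weight *)

Local Open Scope ring_scope.

Lemma coef_prod_vec (g : 'I_n -> 'I_3 -> nat) j :
  (\prod_(i < n) (\sum_(k < 3) (g i k)%:R *: 'X^k) : {poly rat})`_j =
  (\sum_(u : vec3 n | wt u == j) \prod_(i < n) g i (u i))%N%:R.
Proof.
rewrite bigA_distr_bigA coef_sum natr_sum [RHS]big_mkcond /=.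
apply: eq_bigr => u _; rewrite scaler_prod -natr_prod prodrXr coefZ coefXn eq_sym.
by case: eqP => _; rewrite ?mulr1 ?mulr0.
Qed.

Lemma coef_X1_exp m j : (('X + 1) ^+ m : {poly rat})`_j = 'C(m, j)%:R.
Proof.
rewrite exprD1n coef_sum.
under eq_bigr => i _ do rewrite coefMn coefXn.
have [le_jm | lt_mj] := leqP j m.
  rewrite (bigD1 (Ordinal (le_jm : (j < m.+1)%N))) //= eqxx big1 ?addr0 // => i.
  by rewrite -val_eqE /= eq_sym => /negPf ->; rewrite mul0rn.
rewrite bin_small // big1 // => i _; rewrite gtn_eqF ?mul0rn //.
exact: leq_trans (ltn_ord i) lt_mj.
Qed.

(** Coordinatewise, [C(x, v) C(v, u) = C(x, u) C(x - u, v - u)]; summing against [z^v] gives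
    [C(x, u) z^u (1 + z)^(x - u)], and the product over coordinates is compared at
    [z^(wt u + j)]. *)
Lemma sum_binv_level u x j :
  (\sum_(v | wt v == wt u + j) binv v x * binv u v =
   binv u x * 'C(wt x - wt u, j))%N.
Proof.
have [ux|ux] := boolP (lev u x); last first.
  rewrite (binv_eq0 ux) mul0n big1 // => v _.
  have [vx|/binv_eq0 -> //] := boolP (lev v x).
  rewrite (@binv_eq0 u v) ?muln0 //; apply: contra ux => uv.
  by apply/forallP => i; apply: leq_trans (forallP uv i) (forallP vx i).
apply/eqP; rewrite -(eqr_nat rat); apply/eqP.
under eq_bigr do rewrite /binv -big_split.
rewrite -(coef_prod_vec (fun i k => 'C(x i, k) * 'C(k, u i))%N).
under eq_bigr => i _.
  have -> : \sum_(k < 3) ('C(x i, k) * 'C(k, u i))%:R *: 'X^k =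
     ('C(x i, u i))%:R *: ('X^(u i) * ('X + 1) ^+ (x i - u i)) :> {poly rat}.
    move: (forallP ux i).
    case: (x i) (u i) => [[|[|[|//]]] ?] [[|[|[|//]]] ?] //= _;
    rewrite !big_ord_recl big_ord0 /= /bump /= ?subSS ?subn0 ?bin0 ?bin1 ?binn
      ?bin_small // -!mul_polyC; ring.
  over.
rewrite scaler_prod big_split /= !prodrXr -natr_prod.
rewrite sumnB; last by move=> i _; apply: (forallP ux).
by rewrite coefZ coefXnM ltnNge leq_addr addKn coef_X1_exp natrM.
Qed.

Definition cap_poly x y : {poly rat} :=
  \prod_(i < n) (\sum_(k < 3) ('C(y i, k) * 'C(2 - k, 2 - x i))%:R *: 'X^k).

Lemma coef_cap_poly x y j :
  (cap_poly x y)`_j = (\sum_(u | wt u == j) binv u y * cobinv u x)%N%:R.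
Proof.
rewrite /cap_poly (coef_prod_vec (fun i k => 'C(y i, k) * 'C(2 - k, 2 - x i))%N).
by congr _%:R; apply: eq_bigr => u _; rewrite big_split.
Qed.

Lemma coef_cap_poly_gt x y j : (wt y < j)%N -> (cap_poly x y)`_j = 0.
Proof.
move=> lt_yj; rewrite coef_cap_poly big1 // => u /eqP wu.
rewrite binv_eq0 //; apply: contraL lt_yj => /wt_lev.
by rewrite wu -leqNgt.
Qed.

Lemma coef_cap_poly_wt x y : wt x = wt y -> (cap_poly x y)`_(wt y) = (y == x)%:R.
Proof.
move=> wxy; rewrite coef_cap_poly; congr _%:R.
rewrite (bigD1 y) //= binvv mul1n big1 ?addn0 => [|u /andP[/eqP wu neq_uy]].
  have [->|neq_yx] := eqVneq; first exact: cobinvv.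
  rewrite cobinv_eq0 //; apply: contraNN neq_yx => /lev_wt_eq -> //.
  by rewrite wxy.
rewrite binv_eq0 //; apply: contraNN neq_uy => /lev_wt_eq -> //.
by rewrite wu.
Qed.

(* In the variable [w = 1 + z], the factors are [1], ['C(2, x)], [1 + w], [w],
   [2 w] and [w ^ 2]. *)
Lemma dvdp_X1_exp_cap x y :
  ('X + 1) ^+ multisum_cap x y %| cap_poly x y.
Proof.
rewrite /multisum_cap /cap_poly -prodrXr.
apply: (big_ind2 (fun p q : {poly rat} => p %| q)) => [|p q p' q'|i _] //.
  exact: dvdp_mul.
rewrite max0n.
case: (x i) (y i) => [[|[|[|//]]] ?] [[|[|[|//]]] ?] /=;
  rewrite ?expr0 ?dvd1p //; apply/dvdpP.
- exists 2%:R; rewrite !big_ord_recl big_ord0 /= /bump /= ?subSS ?subn0 ?bin0 ?bin1 ?binn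
      ?bin_small // -!mul_polyC; ring.
- exists 1; rewrite !big_ord_recl big_ord0 /= /bump /= ?subSS ?subn0 ?bin0 ?bin1 ?binn
      ?bin_small // -!mul_polyC; ring.
- exists 1; rewrite !big_ord_recl big_ord0 /= /bump /= ?subSS ?subn0 ?bin0 ?bin1 ?binn
      ?bin_small // -!mul_polyC; ring.
Qed.

(** * The shadow inequality by rank *)

Lemma dvdp_Xn (p : {poly rat}) k :
  (forall j, (j < k)%N -> p`_j = 0) -> 'X^k %| p.
Proof.
move=> p0; rewrite -(poly_take_drop k p).
suff -> : take_poly k p = 0 by rewrite add0r dvdp_mull.
by apply/polyP => j; rewrite coef_take_poly coef0; case: ifP => // /p0.
Qed.

(* A vector in the kernel turns [\sum_y c y * cap_poly x y] into a polynomial of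
   degree at most [r] divisible by [z^(r - s + 1) (1 + z)^t], whose coefficient
   of [z^r] is [c x]. *)
Lemma binv_kernel0 r s t F (c : vec3 n -> rat) :
    F \subset level n r -> multisum_intersecting t F -> (s <= t)%N -> (s <= r)%N ->
    (forall v, wt v = (r - s)%N -> \sum_(y in F) c y * (binv v y)%:R = 0) ->
  {in F, forall x, c x = 0}.
Proof.
move=> FL Ft le_st le_sr c0 x xF.
have wF y : y \in F -> wt y = r.
  by move=> /(subsetP FL); rewrite inE => /eqP.
(* The relations descend from level [r - s] to lower levels: weighting them by [binv u v] gives the
   relation for [u] times ['C(r - wt u, k)], which is nonzero and independent of [y]. *)
have c0' u : (wt u <= r - s)%N -> \sum_(y in F) c y * (binv u y)%:R = 0.
  move=> le_u; set k := (r - s - wt u)%N.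
  have : \sum_(v | wt v == (wt u + k)%N)
           (\sum_(y in F) c y * (binv v y)%:R) * (binv u v)%:R = 0.
    apply: big1 => v /eqP wv; rewrite c0 ?mul0r //.
    by rewrite wv subnKC.
  under eq_bigr do rewrite mulr_suml.
  rewrite exchange_big /=.
  under eq_bigr => y yF.
    under eq_bigr do rewrite -mulrA -natrM.
    rewrite -mulr_sumr -natr_sum sum_binv_level wF // natrM mulrA.
    over.
  rewrite -mulr_suml => /eqP; rewrite mulf_eq0 pnatr_eq0 => /orP[/eqP //|].
  rewrite -leqn0 leqNgt bin_gt0 => /negP[].
  by rewrite leq_sub2r // leq_subr.
pose R : {poly rat} := \sum_(y in F) c y *: cap_poly x y.
have R_coef j : R`_j = \sum_(y in F) c y * (cap_poly x y)`_j.
  by rewrite coef_sum; apply: eq_bigr => y _; rewrite coefZ.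
have R_low : 'X^((r - s).+1) %| R.
  apply: dvdp_Xn => j; rewrite ltnS => le_j; rewrite R_coef.
  under eq_bigr => y _.
    rewrite coef_cap_poly natr_sum mulr_sumr.
    under eq_bigr do rewrite natrM mulrA.
    over.
  rewrite exchange_big big1 //= => u /eqP wu.
  by rewrite -mulr_suml c0' ?mul0r // wu.
have R_cap : ('X + 1) ^+ t %| R.
  apply: (big_ind (fun p => ('X + 1) ^+ t %| p)) => [|p q|y yF].
  - exact: dvdp0.
  - exact: dvdp_add.
  rewrite -mul_polyC dvdp_mull // (dvdp_trans _ (dvdp_X1_exp_cap x y)) //.
  apply: dvdp_exp2l.
  by move: Ft => /forall_inP /(_ _ xF) /forall_inP /(_ _ yF).
have sizeR : (size R <= r.+1)%N.
  apply/leq_sizeP => j lt_rj; rewrite R_coef big1 // => y yF.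
  by rewrite coef_cap_poly_gt ?mulr0 // wF.
have R0 : R = 0.
  (* A nonzero [R] would have degree at least [r - s + 1 + t], which exceeds [r] as [s <= t]. *)
  apply/eqP; apply: contraLR sizeR => nz_R; rewrite -ltnNge.
  have cop : coprimep 'X^((r - s).+1) (('X + 1) ^+ t : {poly rat}).
    apply: coprimep_expl; apply: coprimep_expr.
    by rewrite coprimep_sym coprimepX /root !hornerE.
  have : 'X^((r - s).+1) * ('X + 1) ^+ t %| R by rewrite Gauss_dvdp // R_low.
  move=> /(dvdp_leq nz_R); apply: leq_trans.
  have -> : 'X + 1 = 'X - (-1)%:P :> {poly rat} by rewrite polyCN opprK.
  rewrite size_monicM ?monicXn ?expf_neq0 ?polyXsubC_eq0 //.
  by rewrite size_polyXn size_exp_XsubC; lia.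
have := congr1 (fun p : {poly rat} => p`_r) R0; rewrite R_coef coef0.
rewrite (bigD1 x) //= big1 ?addr0 => [|y /andP[yF neq_yx]].
  by rewrite -(wF x) // coef_cap_poly_wt // eqxx mulr1.
by rewrite -(wF y) // coef_cap_poly_wt ?(negPf neq_yx) ?mulr0 // !wF.
Qed.

Lemma leq_card_shadow r s t F :
    F \subset level n r -> multisum_intersecting t F -> (s <= t)%N -> (s <= r)%N ->
  (#|F| <= #|shadow s F|)%N.
Proof.
move=> FL Ft le_st le_sr.
pose A : 'M[rat]_(#|F|, #|shadow s F|) :=
  \matrix_(i, j) (binv (enum_val j) (enum_val i))%:R.
suff : row_free A by rewrite -row_leq_rank => /leq_trans; apply; apply: rank_leq_col.
apply: inj_row_free => v vA0.
(* A nonzero [v] forces [F] to be nonempty, which provides the member that [enum_rank_in]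
   requires. *)
have [->|nz_v] := eqVneq v 0; first by [].
have [x0 x0F] : exists x0, x0 \in F.
  have /existsP[i _] : [exists i, v 0 i != 0].
    rewrite -negb_forall; apply: contra nz_v => /forallP v0.
    by apply/eqP/rowP => i; rewrite mxE; apply/eqP/v0.
  by exists (enum_val i); apply: enum_valP.
pose c y := v 0 (enum_rank_in x0F y).
have wF y : y \in F -> wt y = r.
  by move=> /(subsetP FL); rewrite inE => /eqP.
have c0 : {in F, forall x, c x = 0}.
  apply: (binv_kernel0 FL Ft le_st le_sr) => u wu.
  (* Outside the shadow every [binv u y] is 0; inside, the relation is a column of [v *m A = 0]. *)
  have [uS|uS] := boolP (u \in shadow s F); last first.
    rewrite big1 // => y yF; rewrite binv_eq0 ?mulr0 //.
    apply: contra uS => uy; rewrite inE; apply/exists_inP; exists y => //.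
    by rewrite uy wu wF //= subnK.
  have := congr1 (fun w : 'rV_ _ => w 0 (enum_rank_in uS u)) vA0.
  rewrite !mxE => vAu; apply: etrans vAu.
  rewrite big_enum_val; apply: eq_bigr => i _.
  by rewrite /c enum_valK_in !mxE enum_rankK_in.
apply/rowP => i; rewrite mxE.
by have := c0 _ (enum_valP i); rewrite /c enum_valK_in.
Qed.

End Shadow.

(** * Complements and pairs of levels *)

Definition compl n (x : vec3 n) : vec3 n := [ffun i => rev_ord (x i)].

Lemma val_compl n (x : vec3 n) i : compl x i = 2 - x i :> nat.
Proof. by rewrite ffunE /= subSS. Qed.

Lemma compl_inj n : injective (@compl n).
Proof.
move=> x y eq_xy; apply/ffunP => i; apply: rev_ord_inj.
by have := congr1 (fun f : vec3 n => f i) eq_xy; rewrite !ffunE.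
Qed.

Lemma wt_compl n (x : vec3 n) : wt (compl x) = 2 * n - wt x.
Proof.
rewrite /wt; under eq_bigr do rewrite val_compl.
rewrite sumnB => [|i _]; last by rewrite -ltnS.
by rewrite sum_nat_const card_ord mulnC.
Qed.

Lemma wt_le n (x : vec3 n) : wt x <= 2 * n.
Proof.
rewrite mulnC -[X in X * 2]card_ord -sum_nat_const; apply: leq_sum => i _.
by rewrite -ltnS.
Qed.

Lemma multisum_cap_compl n (x u : vec3 n) :
  lev u x -> multisum_cap x (compl u) = wt x - wt u.
Proof.
move=> /forallP ux; rewrite /wt -sumnB //; apply: eq_bigr => i _.
by rewrite max0n val_compl; have := ux i; have := ltn_ord (u i); lia.
Qed.

Lemma multisum_cap_diag_le n (x : vec3 n) : multisum_cap x x <= wt x.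
Proof.
by apply: leq_sum => i _; rewrite max0n; have := ltn_ord (x i); lia.
Qed.

Lemma multisum_intersecting_sub n t (F G : {set vec3 n}) :
  G \subset F -> multisum_intersecting t F -> multisum_intersecting t G.
Proof.
move=> /subsetP GF /forall_inP Ft.
apply/forall_inP => x /GF xF; apply/forall_inP => y /GF yF.
by move: (Ft _ xF) => /forall_inP; apply.
Qed.

Lemma card_level_pair n (F : {set vec3 n}) r :
    multisum_intersecting 3 F -> 2 <= r ->
  #|F :&: level n r| + #|F :&: level n (2 * n + 2 - r)| <=
  #|level n (2 * n + 2 - r)|.
Proof.
move=> F3 le2r; set Fr := F :&: level n r; set L := level n _.
have Fr3 : multisum_intersecting 3 Fr.
  by apply: multisum_intersecting_sub F3; apply: subsetIl.
have := leq_card_shadow (subsetIr _ _) Fr3 (isT : 2 <= 3) le2r.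
rewrite -(card_imset (shadow 2 Fr) (@compl_inj n)) => le_sh.
rewrite -(cardsID F L) setIC addnC leq_add2l (leq_trans le_sh) //.
apply/subset_leq_card/subsetP => _ /imsetP[u u_sh ->].
move: u_sh; rewrite inE => /exists_inP[x].
rewrite !inE => /andP[xF /eqP wx] /andP[ux /eqP wxu]; rewrite -/(wt x) in wx.
apply/andP; split.
  apply/negP => uF; have /forall_inP/(_ _ xF)/forall_inP/(_ _ uF) := F3.
  by rewrite multisum_cap_compl // wxu addKn.
rewrite -[X in X == _]/(wt _) wt_compl; have := wt_le u; have := wt_le x; lia.
Qed.

(** The pair [x], [x] already violates the intersection bound. *)
Lemma card_level_small n (F : {set vec3 n}) r :
  multisum_intersecting 3 F -> r < 3 -> #|F :&: level n r| = 0.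
Proof.
move=> F3 lt_r3; apply/eqP; rewrite cards_eq0 -subset0; apply/subsetP => x.
rewrite !inE => /andP[xF /eqP wx].
have /forall_inP/(_ _ xF)/forall_inP/(_ _ xF) := F3.
by move/leq_trans/(_ (multisum_cap_diag_le x)); rewrite /wt wx leqNgt lt_r3.
Qed.

(** * Summation over levels *)

Lemma card_sum_level n (A : {set vec3 n}) :
  #|A| = \sum_(0 <= r < (2 * n).+1) #|A :&: level n r|.
Proof.
rewrite big_mkord -sum1_card.
rewrite (partition_big (fun x => inord (wt x) : 'I_(2 * n).+1) predT) //=.
apply: eq_bigr => r _; rewrite -sum1_card; apply: eq_bigl => x.
by rewrite !inE -val_eqE /= inordK // ltnS wt_le.
Qed.

Lemma card_bigcup_level n m :
  \sum_(m <= r < (2 * n).+1) #|level n r| <=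
  #|\bigcup_(m <= r < (2 * n).+1) level n r|.
Proof.
have [le_mn|gt_mn] := leqP m (2 * n).+1; last by rewrite big_geq // ltnW.
rewrite (card_sum_level (\bigcup_(m <= r < _) _)) (@big_cat_nat _ _ _ m 0) //=.
apply: leq_trans (leq_addl _ _).
rewrite [X in X <= _]big_nat [X in _ <= X]big_nat; apply: leq_sum => r r_bd.
apply: subset_leq_card; rewrite subsetI subxx andbT.
by rewrite (big_rem r) ?mem_index_iota //= subsetUl.
Qed.

Theorem theorem4p4 (n : nat) (hn : 1 <= n) (F : {set vec3 n})
  (hF : multisum_intersecting 3 F) :
  #|F| <= #|\bigcup_(n + 2 <= r < (2 * n).+1) level n r| + max_level_size n.
Proof.
apply: leq_trans (leq_add (card_bigcup_level _ _) (leqnn _)).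
rewrite (card_sum_level F).
pose f r := #|F :&: level n r|.
rewrite (@big_cat_nat _ _ _ n.+1) //=; last lia.
rewrite [X in _ + X]big_ltn; last lia.
have mid : f n.+1 <= max_level_size n.
  apply: (@leq_bigmax_cond _ _ (fun G : {set vec3 n} => #|G|)).
  rewrite subsetIr andbT.
  by apply: multisum_intersecting_sub hF; apply: subsetIl.
(* Weights 0 and 1 are split off, since their partner weight [2 * n + 2 - r] would exceed
   [2 * n]. *)
rewrite (@big_cat_nat _ _ _ 2) //=.
rewrite [X in X + _ + _]big_nat big1 ?add0n => [|r /andP[_ lt_r]]; last first.
  by apply: card_level_small => //; lia.
have -> : \sum_(2 <= r < n.+1) #|F :&: level n r| =
          \sum_(n + 2 <= r < (2 * n).+1) f (2 * n + 2 - r).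
  rewrite addnC big_addn big_nat_rev /=.
  have -> : (2 * n).+1 - n = n.+1 by lia.
  by apply: eq_big_nat => r r_bd; congr f; lia.
rewrite addnCA addnC leq_add // addn2 -big_split /=.
rewrite !big_nat; apply: leq_sum => r r_bd.
(* The pairing lemma is applied to the lower level [2 * n + 2 - r]. *)
have -> : r = 2 * n + 2 - (2 * n + 2 - r) by lia.
have -> : 2 * n + 2 - (2 * n + 2 - (2 * n + 2 - r)) = 2 * n + 2 - r by lia.
by apply: card_level_pair; lia.
Qed.
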